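(* Let $\tau$ be a finite language and let $\mathbb{K}$ be a class of $\tau$-structures that is axiomatized by a computable $\bigwedge\!\!\bigwedge$-sentence (i.e. $\mathbb{K}$ is the class of models of such a sentence). Then $\mathbb{K}$ is a $\mathrm{PC}'$-class.
   Context: The $\bigwedge\!\!\bigwedge$-formulas are the infinitary $\mathcal{L}_{\omega_1\omega}$-formulas built from finitary quantifier-free formulas using $\exists$, $\forall$ and countable conjunctions $\bigwedge\!\!\bigwedge_{i\in\omega}$ (of formulas with finitely many free variables in total); no infinitary disjunctions. Computability is via formula codes: fixing a Gödel coding of atomic formulas, connectives and quantifiers, a labeled tree is a nonempty tree $T\subseteq\omega^{<\omega}$ with functions $l$ and $v$ such that each $\sigma\in T$ is either (a) a leaf with $l(\sigma)$ the code of a finite disjunction $\psi$ of atomic and negated atomic formulas and $\{x_i: i\in v(\sigma)\}$ the free variables of $\psi$; (b) $l(\sigma)=\ulcorner\exists x_i\urcorner$, $\sigma^\frown 0$ the unique child, $v(\sigma)=v(\sigma^\frown0)\setminus\{i\}$; (c) same with $\forall x_i$; (d) $l(\sigma)=\ulcorner\bigwedge\!\!\bigwedge\urcorner$ and $v(\sigma)=\bigcup_{\sigma^\frown i\in T}v(\sigma^\frown i)$ is finite; or (e) the same with $\bigvee\!\!\bigvee$. A formula code is a well-founded labeled tree; it codes a formula in the obvious way; it is a sentence code if $v(\varnothing)=\varnothing$. A computable $\bigwedge\!\!\bigwedge$-sentence is one with a sentence code $(T,l,v)$ with $T,l,v$ computable and no node labeled $\ulcorner\bigvee\!\!\bigvee\urcorner$.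 A class $\mathbb{K}$ of $\tau$-structures is a $\mathrm{PC}'$-class if there is a language $\tau^*\supseteq\tau$ containing a unary predicate $P\in\tau^*\setminus\tau$ and a single first-order $\tau^*$-sentence $\phi$ such that $\mathbb{K}=\{\mathcal{A}_P : \mathcal{A}\models\phi \text{ and } \mathcal{A}_P \text{ is defined}\}$, where $\mathcal{A}_P$ denotes the substructure of the reduct $\mathcal{A}|\tau$ with domain $P^{\mathcal{A}}$ (defined only when this is a $\tau$-structure). *)

(* Defs.v *)
From Stdlib Require List.
From mathcomp Require Import all_boot.
Set Implicit Arguments. Unset Strict Implicit. Unset Printing Implicit Defensive.

(* Arguments are passed as a list; missing arguments read as 0.        *)

Inductive recf : Type :=
| RZero : recf
| RSucc : recf
| RProj : nat -> recf
| RComp : recf -> seq recf -> recf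
| RPrim : recf -> recf -> recf
| RMu   : recf -> recf.

Inductive reval : recf -> seq nat -> nat -> Prop :=
| ev_zero xs : reval RZero xs 0
| ev_succ xs : reval RSucc xs (head 0 xs).+1
| ev_proj i xs : reval (RProj i) xs (nth 0 xs i)
| ev_comp f gs xs ys y :
    revals gs xs ys -> reval f ys y -> reval (RComp f gs) xs y
| ev_prim0 f g xs y : reval f xs y -> reval (RPrim f g) (0 :: xs) y
| ev_primS f g n xs z y :
    reval (RPrim f g) (n :: xs) z -> reval g [:: n, z & xs] y ->
    reval (RPrim f g) (n.+1 :: xs) y
| ev_mu f xs n :
    reval f (n :: xs) 0 ->
    (forall m, m < n -> exists k, reval f (m :: xs) k.+1) ->
    reval (RMu f) xs n
with revals : seq recf -> seq nat -> seq nat -> Prop :=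
| evs_nil xs : revals [::] xs [::]
| evs_cons g gs xs y ys :
    reval g xs y -> revals gs xs ys -> revals (g :: gs) xs (y :: ys).

Definition computable (f : nat -> nat) : Prop :=
  exists c : recf, forall n, reval c [:: n] (f n).

Definition cpair (x y : nat) : nat := (((x + y) * (x + y).+1)./2 + y)%N.
Definition seq_code (s : seq nat) : nat := foldr (fun x c => (cpair x c).+1) 0 s.
Definition finset_code (s : seq nat) : nat := (\sum_(i <- undup s) 2 ^ i)%N.

Record lang : Type := Lang {
  fsym : countType;
  rsym : countType;
  farity : fsym -> nat;
  rarity : rsym -> nat }.

Definition finite_lang (L : lang) : Prop :=
  (exists s : seq (fsym L), forall f, f \in s) /\
  (exists s : seq (rsym L), forall r, r \in s).

Inductive term (L : lang) : Type :=
| Var : nat -> term L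
| App : fsym L -> seq (term L) -> term L.

Fixpoint wf_term L (t : term L) : bool :=
  match t with
  | Var _ => true
  | App f ts => (size ts == farity f) && all (@wf_term L) ts
  end.

Fixpoint fv_term L (t : term L) : seq nat :=
  match t with
  | Var n => [:: n]
  | App _ ts => flatten (map (@fv_term L) ts)
  end.

Inductive atomic (L : lang) : Type :=
| AEq : term L -> term L -> atomic L
| ARel : rsym L -> seq (term L) -> atomic L.

Definition wf_atomic L (a : atomic L) : bool :=
  match a with
  | AEq t u => wf_term t && wf_term u
  | ARel r ts => (size ts == rarity r) && all (@wf_term L) ts
  end.

Definition fv_atomic L (a : atomic L) : seq nat :=
  match a with
  | AEq t u => fv_term t ++ fv_term u
  | ARel _ ts => flatten (map (@fv_term L) ts)
  end.

(* a literal: (true, a) is the atomic formula a, (false, a) is its negation *)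
Definition literal (L : lang) : Type := (bool * atomic L)%type.

Inductive fo (L : lang) : Type :=
| FAt : atomic L -> fo L
| FNot : fo L -> fo L
| FAnd : fo L -> fo L -> fo L
| FOr : fo L -> fo L -> fo L
| FEx : nat -> fo L -> fo L
| FAll : nat -> fo L -> fo L.

Fixpoint wf_fo L (p : fo L) : bool :=
  match p with
  | FAt a => wf_atomic a
  | FNot q => wf_fo q
  | FAnd q r | FOr q r => wf_fo q && wf_fo r
  | FEx _ q | FAll _ q => wf_fo q
  end.

Fixpoint fv_fo L (p : fo L) : seq nat :=
  match p with
  | FAt a => fv_atomic a
  | FNot q => fv_fo q
  | FAnd q r | FOr q r => fv_fo q ++ fv_fo r
  | FEx i q | FAll i q => filter (fun j => j != i) (fv_fo q)
  end.

Definition fo_sentence L (p : fo L) : Prop := wf_fo p /\ fv_fo p = [::].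

(* Function/relation symbols are interpreted on argument lists; only   *)
(* lists of the correct arity matter (see [embedding] below).          *)

Record structure (L : lang) : Type := Structure {
  carrier :> Type;
  carrier_nonempty : inhabited carrier;
  funs : forall f : fsym L, seq carrier -> carrier;
  rels : forall r : rsym L, seq carrier -> Prop }.
Arguments carrier {L} s.
Arguments carrier_nonempty {L} s.
Arguments funs {L} s f _.
Arguments rels {L} s r _.

Definition upd (A : Type) (e : nat -> A) (i : nat) (a : A) : nat -> A :=
  fun j => if j == i then a else e j.

Fixpoint eval_term L (A : structure L) (e : nat -> A) (t : term L) : A :=
  match t with
  | Var n => e n
  | App f ts => funs A f (map (eval_term e) ts)
  end.
Arguments eval_term {L} A e t.

Definition sat_atomic L (A : structure L) (e : nat -> A) (a : atomic L) : Prop :=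
  match a with
  | AEq t u => eval_term A e t = eval_term A e u
  | ARel r ts => rels A r (map (eval_term A e) ts)
  end.
Arguments sat_atomic {L} A e a.

Definition sat_literal L (A : structure L) (e : nat -> A) (x : literal L) : Prop :=
  if x.1 then sat_atomic A e x.2 else ~ sat_atomic A e x.2.
Arguments sat_literal {L} A e x.

Fixpoint sat_fo L (A : structure L) (e : nat -> A) (p : fo L) : Prop :=
  match p with
  | FAt a => sat_atomic A e a
  | FNot q => ~ sat_fo e q
  | FAnd q r => sat_fo e q /\ sat_fo e r
  | FOr q r => sat_fo e q \/ sat_fo e r
  | FEx i q => exists a : A, sat_fo (upd e i a) q
  | FAll i q => forall a : A, sat_fo (upd e i a) q
  end.
Arguments sat_fo {L} A e p.

(* Nodes sigma : seq nat, child sigma^i = rcons sigma i.               *)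

Inductive label (L : lang) : Type :=
| LLeaf : seq (literal L) -> label L   (* finite disjunction of literals *)
| LEx : nat -> label L
| LAll : nat -> label L
| LConj : label L
| LDisj : label L.

Definition enc_list (s : seq nat) : nat := seq_code s.

Fixpoint enc_term L (t : term L) : nat :=
  match t with
  | Var n => cpair 0 n
  | App f ts => cpair 1 (cpair (pickle f) (enc_list (map (@enc_term L) ts)))
  end.

Definition enc_atomic L (a : atomic L) : nat :=
  match a with
  | AEq t u => cpair 0 (cpair (enc_term t) (enc_term u))
  | ARel r ts => cpair 1 (cpair (pickle r) (enc_list (map (@enc_term L) ts)))
  end.

Definition enc_literal L (x : literal L) : nat := cpair (nat_of_bool x.1) (enc_atomic x.2).

Definition enc_label L (x : label L) : nat :=
  match x with
  | LLeaf c => cpair 0 (enc_list (map (@enc_literal L) c))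
  | LEx i => cpair 1 i
  | LAll i => cpair 2 i
  | LConj => cpair 3 0
  | LDisj => cpair 4 0
  end.

Definition fv_clause L (c : seq (literal L)) : seq nat :=
  flatten (map (fun x : literal L => fv_atomic x.2) c).

Definition node_ok L (T : pred (seq nat)) (l : seq nat -> label L)
    (v : seq nat -> seq nat) (sigma : seq nat) : Prop :=
  match l sigma with
  | LLeaf c =>
      (forall i, ~~ T (rcons sigma i)) /\
      all (fun x : literal L => wf_atomic x.2) c /\
      (forall x, x \in v sigma <-> x \in fv_clause c)
  | LEx i | LAll i =>
      T (rcons sigma 0) /\ (forall j, T (rcons sigma j) -> j = 0) /\
      (forall x, x \in v sigma <-> (x \in v (rcons sigma 0) /\ x != i))
  | LConj | LDisj =>
      (forall x, x \in v sigma <->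
                 exists j, T (rcons sigma j) /\ x \in v (rcons sigma j))
  end.

Definition labeled_tree L (T : pred (seq nat)) (l : seq nat -> label L)
    (v : seq nat -> seq nat) : Prop :=
  T [::] /\
  (forall sigma i, T (rcons sigma i) -> T sigma) /\
  (forall sigma, T sigma -> node_ok T l v sigma).

Definition well_founded_tree (T : pred (seq nat)) : Prop :=
  ~ (exists g : nat -> nat, forall n, T (mkseq g n)).

Definition formula_code L T (l : seq nat -> label L) v : Prop :=
  labeled_tree T l v /\ well_founded_tree T.

Definition sentence_code L T (l : seq nat -> label L) v : Prop :=
  formula_code T l v /\ (forall x, x \notin v [::]).

Definition computable_conj_sentence L T (l : seq nat -> label L) v : Prop :=
  sentence_code T l v /\
  (exists cT cl cv : nat -> nat,
     [/\ computable cT, computable cl, computable cv &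
      forall sigma,
        cT (seq_code sigma) = nat_of_bool (T sigma) /\
        (T sigma -> cl (seq_code sigma) = enc_label (l sigma) /\
                    cv (seq_code sigma) = finset_code (v sigma))]) /\
  (forall sigma, T sigma -> l sigma <> LDisj L).

(* Satisfaction of the formula coded at node sigma under assignment e.
   Since the tree is well founded, this inductive (least-fixed-point)
   definition is the usual recursive semantics. *)
Inductive holds L (A : structure L) (T : pred (seq nat)) (l : seq nat -> label L)
  : seq nat -> (nat -> A) -> Prop :=
| h_leaf sigma e c :
    l sigma = LLeaf c -> List.Exists (sat_literal A e) c -> @holds L A T l sigma e
| h_ex sigma e i a :
    l sigma = LEx L i -> @holds L A T l (rcons sigma 0) (upd e i a) -> @holds L A T l sigma e
| h_all sigma e i :
    l sigma = LAll L i -> (forall a, @holds L A T l (rcons sigma 0) (upd e i a)) ->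
    @holds L A T l sigma e
| h_conj sigma e :
    l sigma = LConj L ->
    (forall j, T (rcons sigma j) -> @holds L A T l (rcons sigma j) e) -> @holds L A T l sigma e
| h_disj sigma e j :
    l sigma = LDisj L -> T (rcons sigma j) -> @holds L A T l (rcons sigma j) e ->
    @holds L A T l sigma e.

Arguments holds {L} A T l _ _.

Definition models_code L (A : structure L) T (l : seq nat -> label L) : Prop :=
  forall e : nat -> A, holds A T l [::] e.

Definition reduct L L' (ef : fsym L -> fsym L') (er : rsym L -> rsym L')
    (A : structure L') : structure L :=
  @Structure L A (carrier_nonempty A) (fun f => funs A (ef f)) (fun r => rels A (er r)).

Definition embedding L (B C : structure L) (h : B -> C) : Prop :=
  injective h /\
  (forall f (xs : seq B), size xs = farity f ->
     h (funs B f xs) = funs C f (map h xs)) /\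
  (forall r (xs : seq B), size xs = rarity r ->
     (rels B r xs <-> rels C r (map h xs))).

(* B is isomorphic to A_P (and in particular A_P is defined): an
   embedding of B into the L-reduct of A whose image is exactly P^A. *)
Definition iso_relativized_reduct L L' (ef : fsym L -> fsym L') (er : rsym L -> rsym L')
    (P : rsym L') (A : structure L') (B : structure L) : Prop :=
  exists h : B -> A,
    embedding (B := B) (C := reduct ef er A) h /\
    (forall a : A, rels A P [:: a] <-> exists b, h b = a).

Definition PC'_class L (K : structure L -> Prop) : Prop :=
  exists (L' : lang) (ef : fsym L -> fsym L') (er : rsym L -> rsym L')
         (P : rsym L') (phi : fo L'),
    injective ef /\ injective er /\
    (forall f, farity (ef f) = farity f) /\
    (forall r, rarity (er r) = rarity r) /\
    rarity P = 1%N /\ (forall r, er r <> P) /\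
    fo_sentence phi /\
    (forall B : structure L,
       K B <-> exists A : structure L',
                 (forall e : nat -> A, sat_fo A e phi) /\
                 iso_relativized_reduct ef er P A B).

(* Main.v *)
(** The finite theory adds to [L] symbols for arithmetic, assignments, evaluation
of recursive functions and a satisfaction predicate.  All its clauses about
arithmetic, evaluation of [recf] codes and values of terms are Horn, so in an
arbitrary model they force every true fact about standard numerals, whatever
happens at nonstandard elements.  The satisfaction predicate only has clauses
descending from a node to its children; as there are no infinitary disjunctions,
each such clause is first order.  Hence, by induction along the well-founded
(standard) tree, satisfaction at the root forces the sentence to hold in the
relativized part.  Conversely a model of the sentence expands to the model made
of [nat], the given structure, all assignments and all codes, with true
satisfaction; there injectivity of the codings and determinism of [reval] make
the clauses read off computed labels correct. *)

Require Import Defs.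
From HB Require Import structures.
From Stdlib Require List.
From Stdlib Require Import Classical ClassicalEpsilon FunctionalExtensionality.
From mathcomp Require Import all_boot zify.
Set Implicit Arguments. Unset Strict Implicit. Unset Printing Implicit Defensive.

(** * Injectivity of the codings and determinism of recursive evaluation *)

Lemma cpairSr x y : cpair x y.+1 = (cpair x.+1 y).+1.
Proof. by rewrite /cpair addnS addSn addnS. Qed.

(** With [cpairSr] and the value at the origin this gives a recursion along antidiagonals that
    determines [cpair]; the axioms for [FPair] are these equations. *)
Lemma cpairS0 y : cpair y.+1 0 = (cpair 0 y).+1.
Proof. rewrite /cpair !add0n !addn0; lia. Qed.

(** The code lies between consecutive triangular numbers, since [y] is at most [x + y]; this
    recovers [x + y], and then [y]. *)
Lemma cpair_inj x y x' y' : cpair x y = cpair x' y' -> x = x' /\ y = y'.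
Proof.
have step n : (n.+1 * n.+2)./2 = (n * n.+1)./2 + n.+1 by nia.
have mono : {homo (fun n => (n * n.+1)./2) : m n / m <= n}.
  by apply: homo_leq => // [m n p|n]; [exact: leq_trans | rewrite step leq_addr].
rewrite /cpair => e.
have [lt|lt|es] := ltngtP (x + y) (x' + y').
- by have := mono _ _ lt; rewrite step; lia.
- by have := mono _ _ lt; rewrite step; lia.
- by rewrite es in e; lia.
Qed.

Fixpoint recf_nested_ind (Q : recf -> Prop) (qz : Q RZero) (qs : Q RSucc)
    (qp : forall i, Q (RProj i))
    (qc : forall f gs, Q f -> List.Forall Q gs -> Q (RComp f gs))
    (qr : forall f g, Q f -> Q g -> Q (RPrim f g))
    (qm : forall f, Q f -> Q (RMu f)) (c : recf) : Q c :=
  let rec_ c := recf_nested_ind qz qs qp qc qr qm c in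
  match c with
  | RZero => qz
  | RSucc => qs
  | RProj i => qp i
  | RComp f gs => qc f gs (rec_ f)
      ((fix recs gs : List.Forall Q gs :=
          match gs with
          | [::] => List.Forall_nil Q
          | g :: gs' => @List.Forall_cons _ Q g gs' (rec_ g) (recs gs')
          end) gs)
  | RPrim f g => qr f g (rec_ f) (rec_ g)
  | RMu f => qm f (rec_ f)
  end.

Fixpoint term_nested_ind L (Q : term L -> Prop) (qv : forall n, Q (Var L n))
    (qa : forall f ts, List.Forall Q ts -> Q (App f ts)) (t : term L) : Q t :=
  match t with
  | Var n => qv n
  | App f ts => qa f ts
      ((fix recs ts : List.Forall Q ts :=
          match ts with
          | [::] => List.Forall_nil Q
          | t :: ts' => @List.Forall_cons _ Q t ts' (term_nested_ind qv qa t) (recs ts')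
          end) ts)
  end.

(* By induction on the code rather than on the derivation: [ev_mu] nests [reval]
   under an existential, for which no induction hypothesis is generated. *)
Lemma reval_det c xs y y' : reval c xs y -> reval c xs y' -> y = y'.
Proof.
elim/recf_nested_ind: c xs y y' => [||i|f gs IHf IHgs|f g IHf IHg|f IHf] xs y y'.
- by move=> h1 h2; inversion h1; inversion h2.
- by move=> h1 h2; inversion h1; inversion h2.
- by move=> h1 h2; inversion h1; inversion h2.
- move=> h1 h2; inversion h1 as [| | |? ? ? ys ? r1 e1| | |]; subst.
  inversion h2 as [| | |? ? ? ys' ? r2 e2| | |]; subst.
  suff eys : ys = ys' by subst ys'; exact: IHf e1 e2.
  elim: IHgs ys ys' r1 r2 {h1 h2 e1 e2} => [|g gs' IHg _ IH] ys ys' r1 r2.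
    by inversion r1; inversion r2.
  inversion r1; inversion r2; subst; congr (_ :: _); last exact: IH.
  by apply: IHg; eassumption.
- case: xs => [|n xs]; first by move=> h; inversion h.
  elim: n y y' => [|n IHn] y y' h1 h2.
    by inversion h1; inversion h2; subst; apply: IHf; eassumption.
  inversion h1 as [| | | | |? ? ? ? z ? r1 e1|]; subst.
  inversion h2 as [| | | | |? ? ? ? z' ? r2 e2|]; subst.
  by rewrite (IHn _ _ r1 r2) in e1; exact: IHg e1 e2.
- move=> h1 h2.
  inversion h1 as [| | | | | |? ? ? z1 lt1]; inversion h2 as [| | | | | |? ? ? z2 lt2]; subst.
  (* If two search results differ, [f] is zero at the smaller one, yet the larger one requires a
     positive value there. *)
  have [lt|lt|//] := ltngtP y y'.
    by have [k /(IHf _ _ _ z1)] := lt2 _ lt.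
  by have [k /(IHf _ _ _ z2)] := lt1 _ lt.
Qed.

Lemma seq_code_inj : injective seq_code.
Proof.
elim=> [|x s IH] [|y t] //= [] /cpair_inj [-> /IH ->] //.
Qed.

Lemma enc_term_inj L : injective (@enc_term L).
Proof.
elim/term_nested_ind => [n|f ts IH] [m|g us] //= /cpair_inj [] // _; first by move->.
move=> /cpair_inj [/(pcan_inj pickleK) -> /seq_code_inj e]; congr App.
elim: IH us e => [|t ts' IHt _ IHts] [|u us] //= [/IHt -> /IHts ->] //.
Qed.

Lemma enc_terms_inj L : injective (fun ts => enc_list (map (@enc_term L) ts)).
Proof. by move=> ts us /seq_code_inj /(inj_map (@enc_term_inj L)). Qed.

Lemma enc_atomic_inj L : injective (@enc_atomic L).
Proof.
move=> [t u|r ts] [t' u'|r' ts'] /= /cpair_inj [] // _ /cpair_inj [].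
  by move=> /enc_term_inj -> /enc_term_inj ->.
by move=> /(pcan_inj pickleK) -> /enc_terms_inj ->.
Qed.

Lemma enc_literal_inj L : injective (@enc_literal L).
Proof. by move=> [[] a] [[] b] /cpair_inj [] //= _ /enc_atomic_inj ->. Qed.

Lemma enc_label_inj L : injective (@enc_label L).
Proof.
move=> [c|i|i||] [c'|i'|i'||] //= /cpair_inj [] // _ => [/seq_code_inj|->|->] //.
by move=> /(inj_map (@enc_literal_inj L)) ->.
Qed.

(** A node violating [Q] has a child violating it, so dependent choice from the root would produce
    an infinite branch. *)
Lemma wf_tree_ind (T : pred (seq nat)) (Q : seq nat -> Prop) :
  well_founded_tree T ->
  (forall s, T s -> (forall i, T (rcons s i) -> Q (rcons s i)) -> Q s) ->
  T [::] -> Q [::].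
Proof.
move=> wfT step T0; apply: NNPP => nQ0.
pose bad s := T s /\ ~ Q s.
(* The implication sits inside the existential so that the choice function is total; at nodes that
   are not bad the index 0 is a dummy. *)
have next s : exists i, bad s -> bad (rcons s i).
  have [[Ts nQs]|nb] := classic (bad s); last by exists 0.
  apply: NNPP => nx; apply: nQs; apply: step => // i Ti; apply: NNPP => nQi.
  by apply: nx; exists i.
pose nx s := proj1_sig (constructive_indefinite_description _ (next s)).
pose branch n := iter n (fun s => rcons s (nx s)) [::].
have branchE n : mkseq (fun k => nx (branch k)) n = branch n.
  by elim: n => // n IH; rewrite mkseqS IH.
have bad_branch n : bad (branch n).
  elim: n => [//|n IH] /=.
  exact: (proj2_sig (constructive_indefinite_description _ (next (branch n))) IH).
by apply: wfT; exists (fun k => nx (branch k)) => n; rewrite branchE; case: (bad_branch n).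
Qed.

(** * Universal closures and finite conjunctions of first-order formulas *)

Section UniversalClosure.
Variable L : lang.
Implicit Types (A : structure L) (p q : fo L).

Lemma upd_id (T : Type) (e : nat -> T) i : upd e i (e i) = e.
Proof. by apply: functional_extensionality => j; rewrite /upd; case: eqP => [->|]. Qed.

Definition imp p q := FOr (FNot p) q.

Lemma sat_imp A e p q : sat_fo A e (imp p q) <-> (sat_fo A e p -> sat_fo A e q).
Proof. by rewrite /=; split=> [[]|/imply_to_or]. Qed.

Definition close p := foldr (@FAll L) p (fv_fo p).

Lemma fv_foldr_all s p x : x \in fv_fo (foldr (@FAll L) p s) -> x \in fv_fo p /\ x \notin s.
Proof.
elim: s => [|i s IH] //=; rewrite mem_filter => /andP [ne /IH [-> ni]].
by rewrite inE negb_or ne.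
Qed.

Lemma close_sentence p : wf_fo p -> fo_sentence (close p).
Proof.
move=> wfp; split; first by rewrite /close; elim: (fv_fo p).
case e: (fv_fo (close p)) => [|x s] //.
have /fv_foldr_all [] : x \in fv_fo (close p) by rewrite e inE eqxx.
by move=> ->.
Qed.

(** Both sides range over all assignments, so a quantifier is peeled off by instantiating it with
    the value [e i] that the assignment already has. *)
Lemma sat_close A p : (forall e, sat_fo A e (close p)) <-> (forall e, sat_fo A e p).
Proof.
rewrite /close; elim: (fv_fo p) => [|i s IH] //=; rewrite -IH.
split=> h e => [|a]; last exact: h.
by rewrite -(upd_id e i); apply: h.
Qed.

Definition ftrue : fo L := FAt (AEq (Var L 0) (Var L 0)).
Definition conj_fo (ps : seq (fo L)) := foldr (@FAnd L) ftrue ps.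

Lemma sat_conj A ps :
  (forall e, sat_fo A e (conj_fo ps)) <-> (forall p, List.In p ps -> forall e, sat_fo A e p).
Proof.
elim: ps => [|p ps IH] //=; split=> h.
  move=> q [<-|qin] e; first by case: (h e).
  by apply: (proj1 IH _ q qin) => e'; case: (h e').
by move=> e; split; [apply: h; left|apply/IH: e => q qin; apply: h; right].
Qed.

End UniversalClosure.

Lemma In_map (S T : Type) (F : S -> T) s y : List.In y (map F s) -> exists x, y = F x.
Proof. by elim: s => //= x s IH [<-|/IH //]; exists x. Qed.

(** * The expanded language and its axioms *)

(** The [F] symbols act on numbers, finite sequences (tree nodes and argument lists) and
    assignments; the [C] symbols name the constructors of [recf] and of the lists under [RComp]. *)
Inductive fun_sym :=
| FZero | FSucc | FPair | FNil | FCons | FSnoc | FSeqCode | FUpd | FApp | FPush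
| CZero | CSucc | CProj | CComp | CPrim | CMu | CNil | CCons.

(* [QPos] (f, xs, n): f (m :: xs) is positive for all m < n.
   [QVals] (n, k, s, w): [k] codes a list of [n] terms, whose values under the
   assignment [s] are the first [n] values of [w]; assignments also serve as lists
   of values, with [FPush] as cons. *)
Inductive rel_sym :=
| QDom | QNeq | QEval | QEvals | QPos | QSat | QClause | QLit | QVal | QVals.

Definition fun_sym_code (f : fun_sym) : nat :=
  match f with
  | FZero => 0 | FSucc => 1 | FPair => 2 | FNil => 3 | FCons => 4 | FSnoc => 5
  | FSeqCode => 6 | FUpd => 7 | FApp => 8 | FPush => 9 | CZero => 10 | CSucc => 11
  | CProj => 12 | CComp => 13 | CPrim => 14 | CMu => 15 | CNil => 16 | CCons => 17
  end.

Definition fun_sym_decode : nat -> fun_sym :=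
  nth FZero [:: FZero; FSucc; FPair; FNil; FCons; FSnoc; FSeqCode; FUpd; FApp; FPush;
                CZero; CSucc; CProj; CComp; CPrim; CMu; CNil; CCons].

Lemma fun_sym_codeK : cancel fun_sym_code fun_sym_decode.
Proof. by case. Qed.

HB.instance Definition _ := Countable.copy fun_sym (can_type fun_sym_codeK).

Definition rel_sym_code (r : rel_sym) : nat :=
  match r with
  | QDom => 0 | QNeq => 1 | QEval => 2 | QEvals => 3 | QPos => 4 | QSat => 5
  | QClause => 6 | QLit => 7 | QVal => 8 | QVals => 9
  end.

Definition rel_sym_decode : nat -> rel_sym :=
  nth QDom [:: QDom; QNeq; QEval; QEvals; QPos; QSat; QClause; QLit; QVal; QVals].

Lemma rel_sym_codeK : cancel rel_sym_code rel_sym_decode.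
Proof. by case. Qed.

HB.instance Definition _ := Countable.copy rel_sym (can_type rel_sym_codeK).

Definition fun_sym_arity (f : fun_sym) : nat :=
  match f with
  | FZero | FNil | CZero | CSucc | CNil => 0
  | FSucc | FSeqCode | CProj | CMu => 1
  | FPair | FCons | FSnoc | FApp | FPush | CComp | CPrim | CCons => 2
  | FUpd => 3
  end.

Definition rel_sym_arity (r : rel_sym) : nat :=
  match r with
  | QDom => 1
  | QNeq | QSat | QClause | QLit => 2
  | QEval | QEvals | QPos | QVal => 3
  | QVals => 4
  end.

Definition ext_lang (L : lang) : lang :=
  @Lang (Defs.fsym L + fun_sym)%type (rsym L + rel_sym)%type
    (fun f => match f with inl f => farity f | inr f => fun_sym_arity f end)
    (fun r => match r with inl r => rarity r | inr r => rel_sym_arity r end).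

Section ExpandedTheory.
Variable L : lang.
Notation L' := (ext_lang L).

Definition fn (f : fun_sym) (ts : seq (term L')) : term L' := @App L' (inr f) ts.
Definition rl (r : rel_sym) (ts : seq (term L')) : fo L' := FAt (@ARel L' (inr r) ts).
Definition eqf (t u : term L') : fo L' := FAt (AEq t u).

Definition zero := fn FZero [::].
Definition succ t := fn FSucc [:: t].
Definition pair t u := fn FPair [:: t; u].
Definition lnil := fn FNil [::].
Definition lcons t u := fn FCons [:: t; u].
Definition app t u := fn FApp [:: t; u].
Definition numeral (n : nat) : term L' := iter n succ zero.

Fixpoint recf_term (c : recf) : term L' :=
  match c with
  | RZero => fn CZero [::]
  | RSucc => fn CSucc [::]
  | RProj i => fn CProj [:: numeral i]
  | RComp f gs =>
      fn CComp [:: recf_term f;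
                foldr (fun t u => fn CCons [:: t; u]) (fn CNil [::]) (map recf_term gs)]
  | RPrim f g => fn CPrim [:: recf_term f; recf_term g]
  | RMu f => fn CMu [:: recf_term f]
  end.

(** Spreads a list of values coded by one element into [k] arguments, to which a symbol of [L] can
    be applied. *)
Definition entries (k : nat) (t : term L') : seq (term L') :=
  mkseq (fun i => app t (numeral i)) k.

Definition signed (b : bool) (p : fo L') := if b then p else FNot p.

(** Names let later proofs invoke a single axiom. The constructors with arguments are families over
    signs and symbols of [L], hence finite when [L] is. *)
Inductive axiom_name :=
| AxPair00 | AxPairS | AxPairS0 | AxSnocNil | AxSnocCons | AxCodeNil | AxCodeCons
| AxNeq0S | AxNeqS0 | AxNeqSS | AxUpdEq | AxUpdNeq | AxPush0 | AxPushS
| AxEvZero | AxEvSuccNil | AxEvSuccCons | AxEvProjNil | AxEvProj0 | AxEvProjS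
| AxEvComp | AxEvsNil | AxEvsCons | AxEvPrim0 | AxEvPrimS | AxPos0 | AxPosS | AxEvMu
| AxSatRoot | AxSatLeaf | AxSatEx | AxSatAll | AxSatConj
| AxClauseNil | AxClauseCons | AxLitEq of bool | AxLitRel of bool & rsym L
| AxValVar | AxValApp of Defs.fsym L | AxValsNil | AxValsCons.

Definition axiom_names (fs : seq (Defs.fsym L)) (rs : seq (rsym L)) : seq axiom_name :=
  [:: AxPair00; AxPairS; AxPairS0; AxSnocNil; AxSnocCons; AxCodeNil; AxCodeCons;
      AxNeq0S; AxNeqS0; AxNeqSS; AxUpdEq; AxUpdNeq; AxPush0; AxPushS;
      AxEvZero; AxEvSuccNil; AxEvSuccCons; AxEvProjNil; AxEvProj0; AxEvProjS;
      AxEvComp; AxEvsNil; AxEvsCons; AxEvPrim0; AxEvPrimS; AxPos0; AxPosS; AxEvMu;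
      AxSatRoot; AxSatLeaf; AxSatEx; AxSatAll; AxSatConj;
      AxClauseNil; AxClauseCons; AxLitEq true; AxLitEq false;
      AxValVar; AxValsNil; AxValsCons]
  ++ map AxValApp fs ++ map (AxLitRel true) rs ++ map (AxLitRel false) rs.

Lemma mem_axiom_names fs rs k :
  (forall f, f \in fs) -> (forall r, r \in rs) -> List.In k (axiom_names fs rs).
Proof.
move=> hf hr; have mapIn (T : eqType) (F : T -> axiom_name) s x :
    x \in s -> List.In (F x) (map F s).
  by elim: s => [|y s IH] //=; rewrite inE => /orP [/eqP ->|/IH]; [left|right].
have inC s t : List.In k s \/ List.In k t -> List.In k (s ++ t).
  exact: (@List.in_or_app _ s t k).
rewrite /axiom_names; apply: (inC _ _).
have [[f ->]|nof] := classic (exists f, k = AxValApp f).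
  by right; apply: List.in_or_app; left; apply: mapIn.
case: k nof {inC} => [|||||||||||||||||||||||||||||||||||[]|b r||f||] nof;
  try by left; simpl; tauto.
- by right; apply: List.in_or_app; right; apply: List.in_or_app; case: b {nof};
    [left|right]; apply: mapIn.
- by case: nof; exists f.
Qed.

Variables cT cl : recf.

Notation x := (Var L' 0).
Notation y := (Var L' 1).
Notation z := (Var L' 2).
Notation u := (Var L' 3).
Notation v := (Var L' 4).
Notation w := (Var L' 5).

(** Occurs only in premises of axioms: in an arbitrary model it suffices that true evaluations hold,
    and in the standard model determinism excludes a wrong label. *)
Definition label_is (t c : term L') : fo L' :=
  rl QEval [:: recf_term cl; lcons (fn FSeqCode [:: t]) lnil; c].

Definition in_tree (t : term L') : fo L' :=
  rl QEval [:: recf_term cT; lcons (fn FSeqCode [:: t]) lnil; numeral 1].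

(** Free variables are read universally. The numerals leading the pairs are the tags and symbol
    codes of the encodings. [AxEvSuccNil] and [AxEvProjNil] reflect that missing arguments read as
    0. [AxUpdEq] and [AxPush0] are guarded by [QDom] because the standard model replaces a value of
    another sort by a default element. *)
Definition axiom_fo (k : axiom_name) : fo L' :=
  match k with
  | AxPair00 => eqf (pair zero zero) zero
  | AxPairS => eqf (pair x (succ y)) (succ (pair (succ x) y))
  | AxPairS0 => eqf (pair (succ y) zero) (succ (pair zero y))
  | AxSnocNil => eqf (fn FSnoc [:: lnil; x]) (lcons x lnil)
  | AxSnocCons => eqf (fn FSnoc [:: lcons x y; z]) (lcons x (fn FSnoc [:: y; z]))
  | AxCodeNil => eqf (fn FSeqCode [:: lnil]) zero
  | AxCodeCons =>
      eqf (fn FSeqCode [:: lcons x y]) (succ (pair x (fn FSeqCode [:: y])))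
  | AxNeq0S => rl QNeq [:: zero; succ x]
  | AxNeqS0 => rl QNeq [:: succ x; zero]
  | AxNeqSS => imp (rl QNeq [:: x; y]) (rl QNeq [:: succ x; succ y])
  | AxUpdEq => imp (rl QDom [:: z]) (eqf (app (fn FUpd [:: x; y; z]) y) z)
  | AxUpdNeq => imp (rl QNeq [:: y; u]) (eqf (app (fn FUpd [:: x; y; z]) u) (app x u))
  | AxPush0 => imp (rl QDom [:: x]) (eqf (app (fn FPush [:: x; y]) zero) x)
  | AxPushS => eqf (app (fn FPush [:: x; y]) (succ z)) (app y z)
  | AxEvZero => rl QEval [:: fn CZero [::]; x; zero]
  | AxEvSuccNil => rl QEval [:: fn CSucc [::]; lnil; succ zero]
  | AxEvSuccCons => rl QEval [:: fn CSucc [::]; lcons x y; succ x]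
  | AxEvProjNil => rl QEval [:: fn CProj [:: x]; lnil; zero]
  | AxEvProj0 => rl QEval [:: fn CProj [:: zero]; lcons x y; x]
  | AxEvProjS =>
      imp (rl QEval [:: fn CProj [:: x]; y; z])
          (rl QEval [:: fn CProj [:: succ x]; lcons u y; z])
  | AxEvComp =>
      imp (FAnd (rl QEvals [:: y; z; u]) (rl QEval [:: x; u; v]))
          (rl QEval [:: fn CComp [:: x; y]; z; v])
  | AxEvsNil => rl QEvals [:: fn CNil [::]; x; lnil]
  | AxEvsCons =>
      imp (FAnd (rl QEval [:: x; z; u]) (rl QEvals [:: y; z; v]))
          (rl QEvals [:: fn CCons [:: x; y]; z; lcons u v])
  | AxEvPrim0 =>
      imp (rl QEval [:: x; z; u]) (rl QEval [:: fn CPrim [:: x; y]; lcons zero z; u])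
  | AxEvPrimS =>
      imp (FAnd (rl QEval [:: fn CPrim [:: x; y]; lcons v z; u])
                (rl QEval [:: y; lcons v (lcons u z); w]))
          (rl QEval [:: fn CPrim [:: x; y]; lcons (succ v) z; w])
  | AxPos0 => rl QPos [:: x; y; zero]
  | AxPosS =>
      imp (FAnd (rl QPos [:: x; y; z]) (rl QEval [:: x; lcons z y; succ u]))
          (rl QPos [:: x; y; succ z])
  | AxEvMu =>
      imp (FAnd (rl QPos [:: x; y; z]) (rl QEval [:: x; lcons z y; zero]))
          (rl QEval [:: fn CMu [:: x]; y; z])
  | AxSatRoot => rl QSat [:: lnil; x]
  | AxSatLeaf =>
      imp (FAnd (rl QSat [:: x; y]) (label_is x (pair zero z))) (rl QClause [:: z; y])
  | AxSatEx =>
      imp (FAnd (rl QSat [:: x; y]) (label_is x (pair (numeral 1) z)))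
          (FEx 5 (FAnd (rl QDom [:: w])
                       (rl QSat [:: fn FSnoc [:: x; zero]; fn FUpd [:: y; z; w]])))
  | AxSatAll =>
      imp (FAnd (FAnd (rl QSat [:: x; y]) (label_is x (pair (numeral 2) z)))
                (rl QDom [:: w]))
          (rl QSat [:: fn FSnoc [:: x; zero]; fn FUpd [:: y; z; w]])
  | AxSatConj =>
      imp (FAnd (FAnd (rl QSat [:: x; y]) (label_is x (pair (numeral 3) zero)))
                (in_tree (fn FSnoc [:: x; z])))
          (rl QSat [:: fn FSnoc [:: x; z]; y])
  | AxClauseNil => FNot (rl QClause [:: zero; x])
  | AxClauseCons =>
      imp (rl QClause [:: succ (pair x y); z])
          (FOr (rl QLit [:: x; z]) (rl QClause [:: y; z]))
  | AxLitEq b =>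
      imp (FAnd (FAnd (rl QLit [:: pair (numeral b) (pair zero (pair x y)); z])
                      (rl QVal [:: x; z; u]))
                (rl QVal [:: y; z; v]))
          (signed b (eqf u v))
  | AxLitRel b r =>
      imp (FAnd (rl QLit [:: pair (numeral b)
                               (pair (numeral 1) (pair (numeral (pickle r)) x)); y])
                (rl QVals [:: numeral (rarity r); x; y; z]))
          (signed b (FAt (@ARel L' (inl r) (entries (rarity r) z))))
  | AxValVar => rl QVal [:: pair zero x; y; app y x]
  | AxValApp f =>
      imp (rl QVals [:: numeral (farity f); x; y; z])
          (rl QVal [:: pair (numeral 1) (pair (numeral (pickle f)) x); y;
                       @App L' (inl f) (entries (farity f) z)])
  | AxValsNil => rl QVals [:: zero; zero; x; y]
  | AxValsCons =>
      imp (FAnd (rl QVals [:: x; y; z; u]) (rl QVal [:: v; z; w]))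
          (rl QVals [:: succ x; succ (pair v y); z; fn FPush [:: w; u]])
  end.

(** * Well-formedness of the axioms, and their union into one sentence *)

Lemma wf_numeral n : wf_term (numeral n).
Proof. by elim: n => //= n ->. Qed.

Lemma wf_recf_term c : wf_term (recf_term c).
Proof.
elim/recf_nested_ind: c => [||i|f gs IHf IHgs|f g IHf IHg|f IHf] //=;
  rewrite ?wf_numeral ?IHf ?IHg //= andbT.
by elim: IHgs => //= g gs' -> _ ->.
Qed.

Lemma wf_entries k t : wf_term t -> all (@wf_term L') (entries k t).
Proof. by move=> wft; rewrite all_map; apply/allP => i _ /=; rewrite wft wf_numeral. Qed.

Lemma wf_axiom k : wf_fo (axiom_fo k).
Proof.
by case: k => [|||||||||||||||||||||||||||||||||||[]|[] r||f||] /=;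
  rewrite ?wf_numeral ?wf_recf_term ?size_mkseq ?eqxx ?wf_entries.
Qed.

Lemma wf_conj_fo ps : (forall p, List.In p ps -> wf_fo p) -> wf_fo (@conj_fo L' ps).
Proof.
by elim: ps => //= p ps IH h; rewrite h ?IH //; [move=> q ?; apply: h; right|left].
Qed.

Definition axioms fs rs : fo L' := close (conj_fo (map axiom_fo (axiom_names fs rs))).

Lemma axioms_sentence fs rs : fo_sentence (axioms fs rs).
Proof.
apply: close_sentence; apply: wf_conj_fo => p pin; have [k ->] := In_map pin.
exact: wf_axiom.
Qed.

Lemma sat_axioms fs rs (A : structure L') :
  (forall f, f \in fs) -> (forall r, r \in rs) ->
  (forall e, sat_fo A e (axioms fs rs)) <-> (forall k e, sat_fo A e (axiom_fo k)).
Proof.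
move=> hf hr; rewrite sat_close sat_conj; split=> h.
  move=> k; apply: h; exact: (List.in_map axiom_fo _ k (mem_axiom_names k hf hr)).
by move=> p pin; have [k ->] := In_map pin; apply: h.
Qed.

End ExpandedTheory.

(** * Models of the axioms satisfy the coded sentence *)

Lemma mkseq_cons (T : Type) (f : nat -> T) n :
  mkseq f n.+1 = f 0 :: mkseq (fun i => f i.+1) n.
Proof. by rewrite /mkseq /= -[1]addn0 iotaDl -map_comp. Qed.

Section Soundness.
Variables (L : lang) (cT cl : recf) (A : structure (ext_lang L)).
Hypothesis axA : forall k e, sat_fo A e (axiom_fo cT cl k).

Notation F f xs := (@funs (ext_lang L) A (inr f) xs).
Notation R r xs := (@rels (ext_lang L) A (inr r) xs).

Definition num n : A := iter n (fun a => F FSucc [:: a]) (F FZero [::]).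
Arguments num : simpl never.
Definition lst (s : seq nat) : A := foldr (fun n a => F FCons [:: num n; a]) (F FNil [::]) s.
(** Axioms are instantiated by listing the values of the variables 0, 1, 2 and so on; later
    variables get the default zero. *)
Definition asg (xs : seq A) : nat -> A := nth (F FZero [::]) xs.

Lemma ax_imp k xs p q :
  axiom_fo cT cl k = imp p q -> sat_fo A (asg xs) p -> sat_fo A (asg xs) q.
Proof. by move=> e; have := axA k (asg xs); rewrite e sat_imp. Qed.

Lemma eval_numeral e n : eval_term A e (numeral L n) = num n.
Proof. by elim: n => //= n IH; rewrite IH. Qed.

Lemma eval_entries e k t :
  map (eval_term A e) (entries k t) = mkseq (fun i => F FApp [:: eval_term A e t; num i]) k.
Proof. by rewrite -map_comp; apply: eq_map => i /=; rewrite eval_numeral. Qed.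

Lemma numS n : num n.+1 = F FSucc [:: num n].
Proof. by []. Qed.

(** The inner induction moves along an antidiagonal until the second argument is 0; the outer one,
    on the sum, then passes to the previous antidiagonal. *)
Lemma pair_num m n : F FPair [:: num m; num n] = num (cpair m n).
Proof.
have [s] := ubnP (m + n); elim: s m n => // s IHs m n; rewrite ltnS leq_eqVlt.
case/orP => [/eqP|]; last exact: IHs.
elim: n m => [|n IHn] m; last first.
  move=> e; rewrite cpairSr [num (cpair _ _).+1]numS -IHn; last by rewrite -e addSnnS.
  exact: (axA (AxPairS L) (asg [:: num m; num n])).
case: m => [|m] e; first exact: (axA (AxPair00 L) (asg [::])).
rewrite cpairS0 [num (cpair _ _).+1]numS -IHs; last by rewrite -e addn0.
exact: (axA (AxPairS0 L) (asg [:: num 0; num m])).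
Qed.

Lemma snoc_lst s i : F FSnoc [:: lst s; num i] = lst (rcons s i).
Proof.
elim: s => [|n s IH]; first exact: (axA (AxSnocNil L) (asg [:: num i])).
by have /= := axA (AxSnocCons L) (asg [:: num n; lst s; num i]); rewrite IH.
Qed.

Lemma code_lst s : F FSeqCode [:: lst s] = num (seq_code s).
Proof.
elim: s => [|n s IH]; first exact: (axA (AxCodeNil L) (asg [::])).
by have /= := axA (AxCodeCons L) (asg [:: num n; lst s]); rewrite IH pair_num.
Qed.

(** Having [QNeq] in place of negated equality keeps the clauses Horn, so they can be derived for
    numerals whether or not these denote distinct elements of [A]. *)
Lemma neq_num m n : m <> n -> R QNeq [:: num m; num n].
Proof.
elim: m n => [|m IH] [|n] // ne.
- exact: (axA (AxNeq0S L) (asg [:: num n])).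
- exact: (axA (AxNeqS0 L) (asg [:: num m])).
- apply: (ax_imp (k := AxNeqSS L) (xs := [:: num m; num n]) erefl).
  by apply: IH => emn; apply: ne; rewrite emn.
Qed.

(** Each rule of [reval] has its Horn axioms, so true evaluations are derivable; nothing is claimed
    about other tuples satisfying [QEval] in [A]. *)
Lemma eval_recf c xs y :
  reval c xs y -> forall e, R QEval [:: eval_term A e (recf_term L c); lst xs; num y].
Proof.
elim/recf_nested_ind: c xs y => [||i|f gs IHf IHgs|f g IHf IHg|f IHf] xs y h e.
- inversion h; exact: (axA (AxEvZero L) (asg [:: lst xs])).
- have -> : y = (head 0 xs).+1 by inversion h.
  case: xs {h} => [|x xs]; first exact: (axA (AxEvSuccNil L) (asg [::])).
  exact: (axA (AxEvSuccCons L) (asg [:: num x; lst xs])).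
- have -> : y = nth 0 xs i by inversion h.
  rewrite /= eval_numeral; elim: i xs {h} => [|i IHi] [|x xs].
  + exact: (axA (AxEvProjNil L) (asg [:: num 0])).
  + exact: (axA (AxEvProj0 L) (asg [:: num x; lst xs])).
  + exact: (axA (AxEvProjNil L) (asg [:: num i.+1])).
  + apply: (ax_imp (k := AxEvProjS L)
      (xs := [:: num i; lst xs; num (nth 0 xs i); num x]) erefl); exact: IHi.
- inversion h as [| | |? ? ? ys ? r1 e1| | |]; subst.
  apply: (ax_imp (k := AxEvComp L) (xs := [:: eval_term A e (recf_term L f);
    eval_term A e (foldr (fun t u => fn CCons [:: t; u]) (fn CNil [::])
                         (map (recf_term L) gs)); lst xs; lst ys; num y]) erefl).
  split; last exact: (IHf _ _ e1).
  elim: IHgs ys r1 {h e1} => [|g gs' IHg _ IH] ys r1; inversion r1; subst.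
    exact: (axA (AxEvsNil L) (asg [:: lst xs])).
  apply: (ax_imp (k := AxEvsCons L) (xs := [:: eval_term A e (recf_term L g);
    eval_term A e (foldr (fun t u => fn CCons [:: t; u]) (fn CNil [::])
                         (map (recf_term L) gs')); lst xs; num y0; lst ys0]) erefl).
  by split; [exact: IHg|exact: IH].
- case: xs h => [|n xs] h; first by inversion h.
  elim: n y h => [|n IHn] y h.
    inversion h; subst; apply: (ax_imp (k := AxEvPrim0 L)
      (xs := [:: eval_term A e (recf_term L f); eval_term A e (recf_term L g);
                 lst xs; num y]) erefl); exact: IHf.
  inversion h as [| | | | |? ? ? ? z ? r1 e1|]; subst.
  apply: (ax_imp (k := AxEvPrimS L)
      (xs := [:: eval_term A e (recf_term L f); eval_term A e (recf_term L g);
                 lst xs; num z; num n; num y]) erefl).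
  by split; [exact: IHn|exact: (IHg _ _ e1)].
- inversion h as [| | | | | |? ? ? z1 lt1]; subst.
  apply: (ax_imp (k := AxEvMu L)
      (xs := [:: eval_term A e (recf_term L f); lst xs; num y]) erefl).
  split; last exact: (IHf _ _ z1).
  (* [QPos] is built upward from 0, using at each [n] below [y] the positive value provided by the
     search. *)
  elim: y lt1 {h z1} => [|n IHn] lt1.
    exact: (axA (AxPos0 L) (asg [:: eval_term A e (recf_term L f); lst xs])).
  have [k r] := lt1 n (ltnSn n).
  apply: (ax_imp (k := AxPosS L)
      (xs := [:: eval_term A e (recf_term L f); lst xs; num n; num k]) erefl).
  split; last exact: (IHf _ _ r).
  by apply: IHn => m lt; apply: lt1; apply: leqW.
Qed.

(** * Transfer of term values, literals and clauses to the relativized part *)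

Variables (B : structure L) (h : B -> A).
Hypothesis h_emb : embedding (C := reduct (L' := ext_lang L) inl inl A) h.
Hypothesis h_dom : forall a, R QDom [:: a] <-> exists b, h b = a.

Lemma dom_h b : R QDom [:: h b].
Proof. by apply/h_dom; exists b. Qed.

(* [s] only has to agree with [e] on [D], so at the root, where [D] is empty, any
   element represents any assignment. *)
Definition represents (D : pred nat) (s : A) (e : nat -> B) :=
  forall n, n \in D -> F FApp [:: s; num n] = h (e n).

Lemma represents_sub (D D' : pred nat) s e :
  {subset D' <= D} -> represents D s e -> represents D' s e.
Proof. by move=> sub rep n /sub /rep. Qed.

(** The condition on [D'] is the free-variable rule of a quantifier node binding [i]. *)
Lemma represents_upd (D D' : pred nat) s e i b :
  (forall n, n \in D' -> n <> i -> n \in D) ->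
  represents D s e -> represents D' (F FUpd [:: s; num i; h b]) (upd e i b).
Proof.
move=> sub rep n nD; rewrite /upd; case: eqP => [->|ne].
  exact: (ax_imp (k := AxUpdEq L) (xs := [:: s; num i; h b]) erefl (dom_h b)).
rewrite -rep; last exact: sub.
apply: (ax_imp (k := AxUpdNeq L) (xs := [:: s; num i; h b; num n]) erefl).
by apply: neq_num => ein; apply: ne.
Qed.

(** Takes the values of the members as a hypothesis, so that it applies within the induction on
    terms. *)
Lemma val_terms s e ts :
  List.Forall (fun t => R QVal [:: num (enc_term t); s; h (eval_term B e t)]) ts ->
  exists w, R QVals [:: num (size ts); num (enc_list (map (@enc_term L) ts)); s; w] /\
    mkseq (fun i => F FApp [:: w; num i]) (size ts) = map h (map (eval_term B e) ts).
Proof.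
elim=> [|t ts' val_t _ [w [vals_w e_w]]].
  (* No entry of an empty list is read, so any element can serve as [w]. *)
  by exists s; split=> //; exact: (axA (AxValsNil L) (asg [:: s; s])).
exists (F FPush [:: h (eval_term B e t); w]); split.
  rewrite /enc_list /= [num (cpair _ _).+1]numS -pair_num.
  by apply: (ax_imp (k := AxValsCons L) (xs := [:: num (size ts');
    num (enc_list (map (@enc_term L) ts')); s; w; num (enc_term t);
    h (eval_term B e t)]) erefl).
rewrite [size _]/= mkseq_cons /= -e_w; congr (_ :: _).
  exact: (ax_imp (k := AxPush0 L) (xs := [:: h (eval_term B e t); w]) erefl (dom_h _)).
apply: eq_map => i.
exact: (axA (AxPushS L) (asg [:: h (eval_term B e t); w; num i])).
Qed.

Lemma val_term s e t :
  wf_term t -> represents (mem (fv_term t)) s e ->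
  R QVal [:: num (enc_term t); s; h (eval_term B e t)].
Proof.
elim/term_nested_ind: t => [n|f ts IH] wft rep.
  rewrite /= -rep ?inE // -pair_num.
  exact: (axA (AxValVar L) (asg [:: num n; s])).
case/andP: wft => /eqP sz wfts.
have [|w [vals_w e_w]] := @val_terms s e ts.
  elim: IH wfts rep {sz} => [|t ts' IHt _ IHts] //= /andP [wft wfts] rep.
  constructor.
    by apply: IHt => //; apply: represents_sub rep => n nt; rewrite inE /= mem_cat nt.
  by apply: IHts => //; apply: represents_sub rep => n nt; rewrite inE /= mem_cat nt orbT.
(* The embedding turns the value in [B] into the symbol of [A] applied to the images of the
   arguments, which are the entries of [w]. *)
rewrite /= -!pair_num; have [_ [h_fun _]] := h_emb; rewrite h_fun; last by rewrite size_map.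
rewrite sz in vals_w e_w.
have := @ax_imp (AxValApp f) [:: num (enc_list (map (@enc_term L) ts)); s; w] _ _ erefl.
by rewrite /= !eval_numeral eval_entries e_w; apply.
Qed.

Lemma val_args s e ts :
  all (@wf_term L) ts -> represents (mem (flatten (map (@fv_term L) ts))) s e ->
  exists w, R QVals [:: num (size ts); num (enc_list (map (@enc_term L) ts)); s; w] /\
    mkseq (fun i => F FApp [:: w; num i]) (size ts) = map h (map (eval_term B e) ts).
Proof.
move=> wfts rep; apply: val_terms; elim: ts wfts rep => [|t ts IH] //= /andP [wft wfts] rep.
constructor.
  by apply: val_term => //; apply: represents_sub rep => n nt; rewrite inE /= mem_cat nt.
by apply: IH => //; apply: represents_sub rep => n nt; rewrite inE /= mem_cat nt orbT.
Qed.

(** Literals of both signs transfer because [h] is injective and both preserves and reflects the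
    relations. *)
Lemma sat_lit s e x :
  wf_atomic x.2 -> represents (mem (fv_atomic x.2)) s e ->
  R QLit [:: num (enc_literal x); s] -> sat_literal B e x.
Proof.
case: x => b [t u|r ts] /= /andP [].
  move=> wft wfu rep; rewrite /enc_literal /= -!pair_num => lit.
  have val_t : R QVal [:: num (enc_term t); s; h (eval_term B e t)].
    by apply: val_term => //; apply: represents_sub rep => n nt; rewrite inE /= mem_cat nt.
  have val_u : R QVal [:: num (enc_term u); s; h (eval_term B e u)].
    apply: val_term => //; apply: represents_sub rep => n nt.
    by rewrite inE /= mem_cat nt orbT.
  have := @ax_imp (AxLitEq L b) [:: num (enc_term t); num (enc_term u); s;
    h (eval_term B e t); h (eval_term B e u)] _ _ erefl.
  rewrite /= eval_numeral => /(_ (conj (conj lit val_t) val_u)).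
  rewrite /sat_literal; case: b {lit} => /=; first exact: (proj1 h_emb).
  by move=> ne eqtu; apply: ne; rewrite eqtu.
move=> /eqP sz wfts rep; rewrite /enc_literal /= -!pair_num => lit.
have [w [vals_w e_w]] := val_args wfts rep.
rewrite sz in vals_w e_w.
have := @ax_imp (AxLitRel b r) [:: num (enc_list (map (@enc_term L) ts)); s; w] _ _ erefl.
rewrite /= !eval_numeral => /(_ (conj lit vals_w)).
case: h_emb => _ [_ h_rel]; rewrite /sat_literal.
have {h_rel} := h_rel r (map (eval_term B e) ts); rewrite size_map => /(_ sz) /= h_rel.
by case: b {lit} => /=; rewrite eval_entries /= e_w h_rel.
Qed.

(** The list has standard length, so the descent through it ends, and [AxClauseNil] forbids reaching
    the end without a true literal. *)
Lemma sat_clause s e c :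
  all (fun x : literal L => wf_atomic x.2) c -> represents (mem (fv_clause c)) s e ->
  R QClause [:: num (enc_list (map (@enc_literal L) c)); s] ->
  List.Exists (sat_literal B e) c.
Proof.
elim: c => [|x c IH] /=; first by move=> _ _ cls; case: (axA (AxClauseNil L) (asg [:: s])).
move=> /andP [wfx wfc] rep; rewrite /enc_list /= [num (cpair _ _).+1]numS -pair_num => cls.
have := @ax_imp (AxClauseCons L) [:: num (enc_literal x);
  num (enc_list (map (@enc_literal L) c)); s] _ _ erefl cls.
case=> [lit|clc]; [left|right].
  apply: sat_lit lit => //; apply: represents_sub rep => n nx.
  by rewrite inE /fv_clause /= mem_cat nx.
apply: IH clc => //; apply: represents_sub rep => n nx.
by rewrite inE /fv_clause /= mem_cat (nx : n \in fv_clause c) orbT.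
Qed.

(** * Descent of satisfaction along the coded tree *)

Variables (T : pred (seq nat)) (l : seq nat -> label L) (v : seq nat -> seq nat).
Hypothesis sentT : sentence_code T l v.
Hypothesis conjT : forall s, T s -> l s <> LDisj L.
Hypothesis cTP : forall s, reval cT [:: seq_code s] (T s).
Hypothesis clP : forall s, T s -> reval cl [:: seq_code s] (enc_label (l s)).

Lemma label_lst e s : T s ->
  R QEval [:: eval_term A e (recf_term L cl); F FCons [:: F FSeqCode [:: lst s]; F FNil [::]];
              num (enc_label (l s))].
Proof. by move=> /clP /eval_recf; rewrite code_lst; apply. Qed.

Lemma sound : models_code B T l.
Proof.
move=> e; case: sentT => [[[T0 [_ nodeT]] wfT] v0].
pose Q s := forall a e, R QSat [:: lst s; a] -> represents (mem (v s)) a e -> holds B T l s e.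
suff Q0 : Q [::].
  apply: (Q0 (num 0)); first exact: (axA (AxSatRoot L) (asg [:: num 0])).
  by move=> n; rewrite inE /= (negPf (v0 n)).
apply: (wf_tree_ind wfT _ T0) => s Ts IH a {}e sat rep.
have := nodeT _ Ts; have lab := fun e => label_lst e Ts.
rewrite /node_ok; case ls : (l s) (conjT Ts) => [c|i|i||] // _; rewrite ls /= in lab.
- move=> [_ [wfc vc]]; apply: h_leaf ls _; apply: (sat_clause (s := a)) => //.
    by apply: represents_sub rep => n nc; rewrite inE /=; apply/vc.
  apply: (ax_imp (k := AxSatLeaf L)
    (xs := [:: lst s; a; num (enc_list (map (@enc_literal L) c))]) erefl).
  by split=> //; rewrite -pair_num in lab; apply: lab.
- move=> [Ts0 [_ vi]].
  (* The witness in [A] satisfies [QDom], hence is the image of some [b'] in [B]. *)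
  have [|b [/= /h_dom [b' <-] sat']] := @ax_imp (AxSatEx L) [:: lst s; a; num i] _ _ erefl.
    by split=> //; rewrite -pair_num in lab; apply: lab.
  apply: h_ex ls _; apply: IH => //; first by rewrite -snoc_lst; apply: sat'.
  by apply: represents_upd rep => n nv /eqP ne; rewrite inE /=; apply/vi.
- move=> [Ts0 [_ vi]]; apply: h_all ls _ => b; apply: IH => //; last first.
    by apply: represents_upd rep => n nv /eqP ne; rewrite inE /=; apply/vi.
  rewrite -snoc_lst.
  (* The two zeros fill the places of variables 3 and 4, so that [h b] becomes the value of variable
     5. *)
  apply: (ax_imp (k := AxSatAll L) (xs := [:: lst s; a; num i; num 0; num 0; h b]) erefl).
  by split; [split=> //; rewrite -pair_num in lab; apply: lab|exact: dom_h].
- move=> vj; apply: h_conj ls _ => j Tj; apply: IH => //; last first.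
    by apply: represents_sub rep => n nv; rewrite inE /=; apply/vj; exists j.
  rewrite -snoc_lst.
  apply: (ax_imp (k := AxSatConj L) (xs := [:: lst s; a; num j]) erefl).
  split; first by split=> //; rewrite -pair_num in lab; apply: lab.
  rewrite /= snoc_lst code_lst.
  by have := eval_recf (cTP (rcons s j)); rewrite Tj; apply.
Qed.

End Soundness.

(** * The standard model *)

Section Completeness.
Variables (L : lang) (B : structure L) (b0 : B).
Variables (T : pred (seq nat)) (l : seq nat -> label L) (v : seq nat -> seq nat).
Hypothesis treeT : labeled_tree T l v.
Variables cT cl : recf.
Hypothesis cTP : forall s, reval cT [:: seq_code s] (T s).
Hypothesis clP : forall s, T s -> reval cl [:: seq_code s] (enc_label (l s)).

(** The language is one-sorted, so all sorts share one universe; [UElt] is the copy of [B] singled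
    out by [QDom]. *)
Inductive univ :=
| UNat of nat | UElt of B | UAsg of (nat -> B) | ULst of seq nat
| URec of recf | URecs of seq recf.

(* Every element is read in every sort, with a junk default outside its own
   sort, so that the equational axioms need no sort guards. *)
Definition as_nat a := if a is UNat n then n else 0.
Definition as_elt a := if a is UElt b then b else b0.
Definition as_asg a := if a is UAsg e then e else fun=> b0.
Definition as_lst a := if a is ULst s then s else [::].
Definition as_rec a := if a is URec c then c else RZero.
Definition as_recs a := if a is URecs gs then gs else [::].

Definition std_fun (f : fun_sym) (xs : seq univ) : univ :=
  let a0 := nth (UNat 0) xs 0 in
  let a1 := nth (UNat 0) xs 1 in
  let a2 := nth (UNat 0) xs 2 in
  match f with
  | FZero => UNat 0
  | FSucc => UNat (as_nat a0).+1
  | FPair => UNat (cpair (as_nat a0) (as_nat a1))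
  | FNil => ULst [::]
  | FCons => ULst (as_nat a0 :: as_lst a1)
  | FSnoc => ULst (rcons (as_lst a0) (as_nat a1))
  | FSeqCode => UNat (seq_code (as_lst a0))
  | FUpd => UAsg (upd (as_asg a0) (as_nat a1) (as_elt a2))
  | FApp => UElt (as_asg a0 (as_nat a1))
  | FPush => UAsg (fun n => if n is n'.+1 then as_asg a1 n' else as_elt a0)
  | CZero => URec RZero
  | CSucc => URec RSucc
  | CProj => URec (RProj (as_nat a0))
  | CComp => URec (RComp (as_rec a0) (as_recs a1))
  | CPrim => URec (RPrim (as_rec a0) (as_rec a1))
  | CMu => URec (RMu (as_rec a0))
  | CNil => URecs [::]
  | CCons => URecs (as_rec a0 :: as_recs a1)
  end.

(** Syntax is quantified existentially and pinned down by injectivity of the encodings. [QSat]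
    includes membership in [T] because [clP] gives labels only at nodes of the tree. *)
Definition std_rel (r : rel_sym) (xs : seq univ) : Prop :=
  let a0 := nth (UNat 0) xs 0 in
  let a1 := nth (UNat 0) xs 1 in
  let a2 := nth (UNat 0) xs 2 in
  let a3 := nth (UNat 0) xs 3 in
  match r with
  | QDom => exists b, UElt b = a0
  | QNeq => as_nat a0 <> as_nat a1
  | QEval => reval (as_rec a0) (as_lst a1) (as_nat a2)
  | QEvals => revals (as_recs a0) (as_lst a1) (as_lst a2)
  | QPos => forall m, m < as_nat a2 -> exists k, reval (as_rec a0) (m :: as_lst a1) k.+1
  | QSat => T (as_lst a0) /\ holds B T l (as_lst a0) (as_asg a1)
  | QClause => exists c, as_nat a0 = enc_list (map (@enc_literal L) c) /\
                         List.Exists (sat_literal B (as_asg a1)) c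
  | QLit => exists x, as_nat a0 = enc_literal x /\ sat_literal B (as_asg a1) x
  | QVal => exists t, as_nat a0 = enc_term t /\ a2 = UElt (eval_term B (as_asg a1) t)
  | QVals => exists ts,
      [/\ size ts = as_nat a0, as_nat a1 = enc_list (map (@enc_term L) ts) &
          map (eval_term B (as_asg a2)) ts = mkseq (as_asg a3) (size ts)]
  end.

Definition std_model : structure (ext_lang L) :=
  @Structure (ext_lang L) univ (inhabits (UNat 0))
    (fun f xs => match f with
                 | inl f => UElt (funs B f (map as_elt xs))
                 | inr f => std_fun f xs
                 end)
    (fun r xs => match r with
                 | inl r => rels B r (map as_elt xs)
                 | inr r => std_rel r xs
                 end).

Lemma std_numeral e n : eval_term std_model e (numeral L n) = UNat n.
Proof. by elim: n => //= n ->. Qed.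

Lemma std_recf_term e c : eval_term std_model e (recf_term L c) = URec c.
Proof.
elim/recf_nested_ind: c => [||i|f gs IHf IHgs|f g IHf IHg|f IHf] //=.
- by rewrite std_numeral.
- rewrite IHf /=; congr (URec (RComp _ _)).
  by elim: IHgs => //= g gs' -> _ ->.
- by rewrite IHf IHg.
- by rewrite IHf.
Qed.

Lemma std_entries e k t :
  map as_elt (map (eval_term std_model e) (entries k t)) =
  mkseq (as_asg (eval_term std_model e t)) k.
Proof. by rewrite -!map_comp; apply: eq_map => i /=; rewrite std_numeral. Qed.

Lemma reval_label s n : T s -> reval cl [:: seq_code s] n -> enc_label (l s) = n.
Proof. by move=> /clP r /(reval_det r). Qed.

Lemma std_axioms k e : models_code B T l -> sat_fo std_model e (axiom_fo cT cl k).
Proof.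
move=> modB; case: treeT => T0 [_ nodeT].
case: k => [|||||||||||||||||||||||||||||||||||b|b r||f||];
  try (apply/sat_imp); rewrite /= ?std_recf_term ?std_numeral //=.
- by rewrite cpairSr.
- by rewrite cpairS0.
- by move=> ne [].
- by case=> b <-; rewrite /upd eqxx.
- by move=> /nesym/eqP/negPf ne; rewrite /upd ne.
- by case=> b <-.
- exact: ev_zero.
- exact: (ev_succ [::]).
- exact: (ev_succ (_ :: _)).
(* The value 0 is presented as the default entry of the empty list. *)
- by rewrite -[X in reval _ _ X](nth_nil 0 (as_nat (e 0))); apply: ev_proj.
- exact: (ev_proj 0 (_ :: _)).
- move=> r; have -> : as_nat (e 2) = nth 0 (as_lst (e 1)) (as_nat (e 0)) by inversion r.
  exact: (ev_proj _.+1 (_ :: _)).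
- by case; apply: ev_comp.
- exact: evs_nil.
- by case; apply: evs_cons.
- exact: ev_prim0.
- by case; apply: ev_primS.
- case=> pos r m; rewrite ltnS leq_eqVlt => /orP [/eqP ->|/pos //].
  by exists (as_nat (e 3)).
- by case=> pos r; apply: ev_mu.
(* Inverting [hs] reveals the true label; the tag of the computed label leaves only the leaf
   case. *)
- move=> [[Ts hs] /(reval_label Ts)].
  inversion hs as [? ? c ls ex|? ? i b ls|? ? i ls|? ? ls|? ? j ls]; subst;
    rewrite ls => /cpair_inj [] // _ <-; by exists c.
(* [node_ok] puts the unique child in the tree, as [QSat] requires. *)
- move=> [[Ts hs] /(reval_label Ts)]; have := nodeT _ Ts; rewrite /node_ok.
  inversion hs as [? ? c ls ex|? ? i b ls hb|? ? i ls|? ? ls|? ? j ls]; subst;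
    rewrite ls => nd /cpair_inj [] // _ ei.
  exists (UElt b); case: nd => Ts0 _; split; first by exists b.
  by rewrite /upd /= -ei.
- move=> [[[Ts hs] lab] [b <-]]; have := reval_label Ts lab; have := nodeT _ Ts; rewrite /node_ok.
  inversion hs as [? ? c ls ex|? ? i b' ls|? ? i ls hb|? ? ls|? ? j ls]; subst;
    rewrite ls => nd /cpair_inj [] // _ <-.
  by case: nd => Ts0 _; split=> //; apply: hb.
(* By determinism the computed value 1 is the value of [T] at the child, which is therefore a
   node. *)
- move=> [[[Ts hs] lab] /(reval_det (cTP _)) Tj]; have := reval_label Ts lab.
  inversion hs as [? ? c ls ex|? ? i b ls|? ? i ls|? ? ls hj|? ? j ls]; subst;
    rewrite ls => /cpair_inj [] // _ _.
  have {}Tj : T (rcons (as_lst (e 0)) (as_nat (e 2))) by case: (T _) Tj.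
  by split=> //; apply: hj.
- by case=> [[|x c]] [] // _ ex; inversion ex.
- case=> [[|x c]] [] //= [] /cpair_inj [ex ec] sat.
  by inversion sat; [left; exists x|right; exists c].
(* The tag excludes a relational literal; injectivity then identifies sign and terms with those of
   the axiom. *)
- move=> [[[[b' [t u|r ts]] [ec sat]] [t' [et e3]]] [u' [eu e4]]]; last first.
    by move: ec => /cpair_inj [_] /cpair_inj [].
  move: ec; rewrite et eu => /cpair_inj [eb /cpair_inj [_ /cpair_inj]].
  move=> [/enc_term_inj et' /enc_term_inj eu']; subst t' u'.
  have -> : b = b' by case: b b' eb {sat} => [] [].
  case: b' sat {eb}; rewrite /sat_literal /= e3 e4; first by move->.
  by move=> ne [/ne].
- move=> [[[b' [t u|r' ts]] [ec sat]] [us [size_us eu vals_us]]].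
    by move: ec => /cpair_inj [_] /cpair_inj [].
  move: ec; rewrite eu => /cpair_inj [eb /cpair_inj [_ /cpair_inj]].
  move=> [/(pcan_inj pickleK) er /enc_terms_inj ets]; subst r' us.
  have -> : b = b' by case: b b' eb {sat} => [] [].
  have args : map as_elt (map (eval_term std_model e) (entries (rarity r) (Var _ 2))) =
              map (eval_term B (as_asg (e 1))) ts by rewrite std_entries vals_us size_us.
  by case: b' sat {eb}; rewrite /sat_literal /= args.
- by exists (Var L (as_nat (e 0))).
- move=> [ts [size_ts ets vals_ts]]; exists (App f ts); split; first by rewrite ets.
  by rewrite std_entries /= vals_ts size_ts.
- by exists [::].
- move=> [[ts [size_ts ets vals_ts]] [t [et ->]]]; exists (t :: ts).
  by split; rewrite /= ?size_ts // ?et ?ets // mkseq_cons vals_ts size_ts.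
Qed.

Lemma std_embedding :
  embedding (C := reduct (L' := ext_lang L) inl inl std_model) UElt.
Proof.
by split=> [b b' []|] //; split=> s xs _ /=; rewrite -map_comp /comp /= map_id.
Qed.

End Completeness.

(** * The class as relativized reducts of models of the axioms *)

Theorem theorem1p4 (L : lang) (K : structure L -> Prop) :
  finite_lang L ->
  (exists (T : pred (seq nat)) (l : seq nat -> label L) (v : seq nat -> seq nat),
     computable_conj_sentence T l v /\
     (forall B : structure L, K B <-> models_code B T l)) ->
  PC'_class K.
Proof.
move=> [[fs hfs] [rs hrs]] [T [l [v [[sentT [[fT [fl [fv [cT cl _ code]]]] conjT]] KE]]]].
case: cT => cT hcT; case: cl => cl hcl.
have cTP s : reval cT [:: seq_code s] (T s) by rewrite -(code s).1.
have clP s : T s -> reval cl [:: seq_code s] (enc_label (l s)).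
  by move=> Ts; rewrite -((code s).2 Ts).1.
exists (ext_lang L), inl, inl, (inr QDom), (axioms cT cl fs rs).
do 5 (split; first by [move=> ? ? []|]); split; first by [].
split; first exact: axioms_sentence.
move=> B; rewrite KE; split=> [modB|[A [/(sat_axioms _ _ _ hfs hrs) axA [h [h_emb h_dom]]]]].
  (* Nonemptiness of [B] supplies the default element of the standard model. *)
  case: (carrier_nonempty B) => b0; exists (std_model b0 T l); split.
    by apply/sat_axioms => // k e; exact: (std_axioms (proj1 (proj1 sentT)) cTP clP).
  by exists (@UElt L B); split; [exact: std_embedding|].
exact: (sound axA h_emb h_dom sentT conjT cTP clP).
Qed.
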